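(* Let $\tilde r(f,x)$ be the generalized Floater--Hormann interpolant corresponding to fixed parameters $d,\gamma\in\mathbb{N}$ with $\gamma\ge2$, arbitrarily large $n\ge d$, and a distribution of nodes $a=x_0<x_1<\dots<x_n=b$ satisfying $h\sim h^*\sim n^{-1}$. For any integer $1\le s\le d+1$, if $f\in C^s([a,b])$ then $$|f(x)-\tilde r(f,x)|\le C\begin{cases}\dfrac1{n^s}&\text{if }\gamma>s+1,\\[2mm]\dfrac{\log n}{n^s}&\text{if }\gamma=s+1,\\[2mm]\dfrac1{n^{\gamma-1}}&\text{if }1<\gamma<s+1,\end{cases}\qquad\forall x\in[a,b],$$ where $C>0$ is a constant independent of $n$ and $x$, bounded with respect to $\gamma>1$ but exponentially growing with $d$.
   Context: $\mathbb{N}=\{1,2,3,\ldots\}$. $C^s([a,b])$ is the class of functions that are $s$ times continuously differentiable on $[a,b]$. For nodes $a=x_0<\dots<x_n=b$ (depending on $n$), $h=\max_{0\le k<n}(x_{k+1}-x_k)$ and $h^*=\min_{0\le k<n}(x_{k+1}-x_k)$; $u\sim v$ means that the ratio $u/v$ lies between two absolute positive constants (independent of $n$). For $i=0,\ldots,n-d$ let $p_i$ be the unique polynomial of degree $\le d$ interpolating $f$ at $x_i,\ldots,x_{i+d}$, and let $\tilde\lambda_i(x)=(-1)^{i\gamma}\prod_{j=i}^{i+d}(x-x_j)^{-\gamma}$. The generalized Floater--Hormann interpolant of $f$ is $$\tilde r(f,x)=\frac{\sum_{i=0}^{n-d}\tilde\lambda_i(x)p_i(x)}{\sum_{i=0}^{n-d}\tilde\lambda_i(x)},$$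 a rational function without real poles, with $\tilde r(f,x_k)=f(x_k)$ at the nodes. The constant $C$ may depend on $f$, $s$, $[a,b]$ and the constants implicit in $h\sim h^*\sim n^{-1}$.
   Formalization: In the case γ = s+1 the formal statement also assumes n ≥ 2, because for n = d = 1 the bound log n / n^s is zero and the printed estimate fails (e.g. f(x) = x², s = 1, γ = 2). *)

(* Defs.v *)
From HB Require Import structures.
From mathcomp Require Import all_boot all_order all_algebra.
From mathcomp Require Import all_classical all_reals all_analysis.

Set Implicit Arguments.
Unset Strict Implicit.
Unset Printing Implicit Defensive.

Import Order.TTheory GRing.Theory Num.Theory.
Import numFieldNormedType.Exports.

Local Open Scope classical_set_scope.
Local Open Scope ring_scope.

Section FloaterHormann.
Variable R : realType.
Implicit Types (a b m M u v t : R) (f g : R -> R) (x : nat -> R).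
Implicit Types (n d gamma s i j k : nat).

(* The derivative is taken relative to [a, b], hence one-sided at a and b;
   values of f and g outside [a, b] are irrelevant. *)
Definition derivative_on a b f g : Prop :=
  forall u, a <= u <= b ->
    (fun v => (f v - f u) / (v - u)) @ within `[a, b] u^' --> g u.

(* f is in C^s([a, b]) *)
Fixpoint Cs a b s f : Prop :=
  if s is s'.+1 then exists g, derivative_on a b f g /\ Cs a b s' g
  else {within `[a, b], continuous f}.

Definition grid a b n x : Prop :=
  [/\ x 0%N = a, x n = b & forall k, (k < n)%N -> x k < x k.+1].

(* The indices of the two big operators below (0 and x n - x 0) are harmless
   because on a grid every gap lies between them. *)
Definition hmax n x : R := \big[Num.max/0]_(k < n) (x k.+1 - x k).

Definition hmin n x : R := \big[Num.min/x n - x 0%N]_(k < n) (x k.+1 - x k).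

(* u ~ v, with the constants m and M made explicit *)
Definition sim m M u v : Prop := m <= u / v <= M.

(* p_i, in Lagrange form; see size_interp, horner_interp and interp_uniq *)
Definition interp d x f i : {poly R} :=
  \sum_(i <= j < (i + d).+1)
    f (x j) *: \prod_(i <= k < (i + d).+1 | k != j)
                 ((x j - x k)^-1 *: ('X - (x k)%:P)).

Definition lambda d gamma x i t : R :=
  (-1) ^+ (i * gamma) * \prod_(i <= j < (i + d).+1) (t - x j) ^- gamma.

(* At the nodes the quotient below is 0 / 0; the singularities are removable
   and the rational function takes the values of f there.  Lemma gFH_rational
   checks that this is the value given by clearing the denominators. *)
Definition gFH n d gamma x f t : R :=
  if [exists k : 'I_n.+1, t == x k] then f t
  else (\sum_(0 <= i < (n - d).+1) lambda d gamma x i t * (interp d x f i).[t])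
       / \sum_(0 <= i < (n - d).+1) lambda d gamma x i t.

Definition rate s gamma n : R :=
  if (s.+1 < gamma)%N then (n%:R ^+ s)^-1
  else if gamma == s.+1 then ln n%:R / n%:R ^+ s
  else (n%:R ^+ (gamma - 1))^-1.

Lemma size_interp d x f i : (size (interp d x f i) <= d.+1)%N.
Proof.
apply: (leq_trans (size_sum _ _ _)); apply/bigmax_leqP_seq => j.
rewrite mem_index_iota => jid _; apply: (leq_trans (size_scale_leq _ _)).
have sz (r : seq nat) (P : pred nat) :
    (size (\prod_(k <- r | P k) ((x j - x k)^-1 *: ('X - (x k)%:P)))%R
     <= (count P r).+1)%N.
  elim: r => [|k r IHr]; first by rewrite big_nil size_poly1.
  rewrite big_cons /=; case: (P k) => //=.
  apply: (leq_trans (size_polyMleq _ _)).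
  have := size_scale_leq (x j - x k)^-1 ('X - (x k)%:P).
  rewrite size_XsubC => s2.
  by rewrite -subn1 leq_subLR; exact: leq_add s2 IHr.
apply: (leq_trans (sz _ _)); rewrite ltnS.
have := count_predC (pred1 j) (index_iota i (i + d).+1).
rewrite count_uniq_mem ?iota_uniq // mem_index_iota jid size_iota.
by rewrite subSn ?leq_addr // addKn add1n => -[->].
Qed.

Definition distinct_nodes d x i : Prop := forall j k,
  (i <= j <= i + d)%N -> (i <= k <= i + d)%N -> j != k -> x j != x k.

Lemma horner_interp d x f i j : distinct_nodes d x i ->
  (i <= j <= i + d)%N -> (interp d x f i).[x j] = f (x j).
Proof.
move=> dx jid; rewrite /interp horner_sum.
rewrite (bigD1_seq j) ?iota_uniq ?mem_index_iota ?ltnS //=.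
rewrite hornerZ horner_prod big_seq_cond big1 ?mulr1; last first.
  move=> k; rewrite mem_index_iota ltnS => /andP[kid kj].
  by rewrite !hornerE mulVf // subr_eq0 eq_sym dx.
rewrite big_seq_cond big1 ?addr0 // => k.
rewrite mem_index_iota ltnS => /andP[kid kj].
rewrite hornerZ horner_prod (big_rem j) ?mem_index_iota ?ltnS //= eq_sym kj.
by rewrite hornerZ hornerXsubC subrr !(mulr0, mul0r).
Qed.

Lemma interp_uniq d x f i (p : {poly R}) : distinct_nodes d x i ->
  (size p <= d.+1)%N ->
  (forall j, (i <= j <= i + d)%N -> p.[x j] = f (x j)) -> p = interp d x f i.
Proof.
move=> dx sp px; apply/eqP; rewrite -subr_eq0; apply/eqP.
apply: (@roots_geq_poly_eq0 _ _ [seq x j | j <- iota i d.+1]).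
- rewrite all_map; apply/allP => j; rewrite mem_iota addnS ltnS => jid /=.
  by rewrite rootE hornerD hornerN px // horner_interp // subrr.
- rewrite map_inj_in_uniq ?iota_uniq // => j k.
  rewrite !mem_iota addnS !ltnS => jid kid xjk.
  by apply/eqP/negP => /negP jk; have := dx _ _ jid kid jk; rewrite xjk eqxx.
- rewrite size_map size_iota (leq_trans (size_polyD _ _)) //.
  by rewrite size_polyN geq_max sp size_interp.
Qed.

(* lambda_i multiplied by the prod_j (t - x_j)^gamma over all the nodes *)
Definition clambda n d gamma x i : {poly R} :=
  (-1) ^+ (i * gamma) *:
  \prod_(0 <= j < n.+1 | ~~ (i <= j <= i + d)%N) ('X - (x j)%:P) ^+ gamma.

Definition gFHnum n d gamma x f : {poly R} :=
  \sum_(0 <= i < (n - d).+1) clambda n d gamma x i * interp d x f i.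

Definition gFHden n d gamma x : {poly R} :=
  \sum_(0 <= i < (n - d).+1) clambda n d gamma x i.

Lemma grid_lt a b n x j k : grid a b n x ->
  (j < k)%N -> (k <= n)%N -> x j < x k.
Proof.
move=> [_ _ xS]; elim: k => // k IHk; rewrite ltnS leq_eqVlt => /orP[/eqP->|jk] kn.
  exact: xS.
by apply: (lt_trans (IHk jk (ltnW kn))); exact: xS.
Qed.

Lemma grid_distinct a b n d x i : grid a b n x -> (i + d <= n)%N ->
  distinct_nodes d x i.
Proof.
move=> gx idn j k /andP[_ jd] /andP[_ kd].
by rewrite neq_ltn => /orP[] jk; [rewrite lt_eqF|rewrite gt_eqF] => //;
  apply: (grid_lt gx) => //; apply: leq_trans idn.
Qed.

Lemma clambda_node0 n d gamma x i k : (0 < gamma)%N -> (k <= n)%N ->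
  ~~ (i <= k <= i + d)%N -> (clambda n d gamma x i).[x k] = 0.
Proof.
move=> g0 kn kid; rewrite /clambda hornerZ horner_prod.
rewrite (big_rem k) ?mem_index_iota ?ltnS //= kid.
by rewrite horner_exp hornerXsubC subrr expr0n gtn_eqF // mul0r mulr0.
Qed.

Lemma clambda_node_gt0 a b n d gamma x i k : grid a b n x ->
  (i + d <= n)%N -> (i <= k <= i + d)%N ->
  0 < (-1) ^+ ((n - d) * gamma) * (clambda n d gamma x i).[x k].
Proof.
move=> gx idn /andP[ik kid].
rewrite /clambda hornerZ horner_prod.
under eq_bigr do rewrite horner_exp hornerXsubC.
have -> : (-1) ^+ ((n - d) * gamma) =
    (-1) ^+ (i * gamma) * ((-1) ^+ gamma) ^+ (n - (i + d)) :> R.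
  by rewrite -exprM -exprD [(gamma * _)%N]mulnC -mulnDl addnBA // subnDl.
rewrite mulrACA -expr2 sqrr_sign mul1r.
have -> : ((-1) ^+ gamma) ^+ (n - (i + d)) =
    \prod_(0 <= j < n.+1 | ~~ (i <= j <= i + d)%N)
       (if (i + d < j)%N then (-1) ^+ gamma else 1) :> R.
  rewrite big_mkcond (@big_cat_nat _ _ _ (i + d).+1) //=.
  rewrite big_nat big1 ?mul1r; last first.
    by move=> j /andP[_]; rewrite ltnS ltnNge => ->; rewrite if_same.
  rewrite (eq_big_nat _ _ (F2 := fun=> (-1) ^+ gamma)); last first.
    by move=> j /andP[idj _]; rewrite idj (leqNgt j) idj andbF.
  by rewrite prodr_const_nat subSS.
rewrite -big_split /= big_seq_cond prodr_gt0 // => j.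
rewrite mem_index_iota /= ltnS => /andP[jn jid].
case: ifPn => [idj|]; last rewrite -leqNgt => jd.
  by rewrite -exprMn mulN1r opprB exprn_gt0 // subr_gt0 (grid_lt gx) //
     (leq_ltn_trans kid).
rewrite mul1r exprn_gt0 // subr_gt0 (grid_lt gx) //; last exact: leq_trans idn.
by apply: leq_trans ik; rewrite ltnNge; move: jid; rewrite jd andbT.
Qed.

Lemma gFHden_node a b n d gamma x k : grid a b n x -> (0 < gamma)%N ->
  (d <= n)%N -> (k <= n)%N -> (gFHden n d gamma x).[x k] != 0.
Proof.
move=> gx g0 dn kn.
suff : 0 < (-1) ^+ ((n - d) * gamma) * (gFHden n d gamma x).[x k].
  by apply: contraTneq => ->; rewrite mulr0 ltxx.
rewrite /gFHden horner_sum mulr_sumr.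
have pos i : (i <= n - d)%N -> (i <= k <= i + d)%N ->
    0 < (-1) ^+ ((n - d) * gamma) * (clambda n d gamma x i).[x k].
  by move=> ind; apply: (clambda_node_gt0 _ gx); rewrite addnC -leq_subRL.
rewrite (bigD1_seq (k - d)%N) ?iota_uniq ?mem_index_iota ?ltnS ?leq_sub2r //=.
rewrite ltr_pwDl //; first by apply: pos; rewrite ?leq_sub2r //
  ?leq_subr /= addnC -leq_subLR.
rewrite big_seq_cond sumr_ge0 // => i; rewrite mem_index_iota ltnS /= => /andP[ind _].
case: (boolP (i <= k <= i + d)%N) => [/(pos _ ind)/ltW//|kid].
by rewrite clambda_node0 ?mulr0.
Qed.

Lemma gFH_rational a b n d gamma x f t : grid a b n x -> (0 < gamma)%N ->
  (d <= n)%N -> gFH n d gamma x f t =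
                (gFHnum n d gamma x f).[t] / (gFHden n d gamma x).[t].
Proof.
move=> gx g0 dn; rewrite /gFH; case: ifPn => [/existsP[k /eqP ->]|].
  have kn : (k <= n)%N by rewrite -ltnS.
  apply/eqP; rewrite eq_sym (can2_eq (divfK _) (mulfK _)) ?(gFHden_node gx) //.
  apply/eqP; rewrite /gFHnum /gFHden !horner_sum mulr_sumr.
  apply: eq_big_nat => i /andP[_]; rewrite ltnS => ind; rewrite hornerM mulrC.
  case: (boolP (i <= k <= i + d)%N) => kid.
    rewrite horner_interp //; apply: (grid_distinct gx).
    by rewrite addnC -leq_subRL.
  by rewrite clambda_node0 // !mulr0.
rewrite negb_exists => /forallP tx.
have tx0 j : (j <= n)%N -> t - x j != 0.
  by rewrite -ltnS => jn; rewrite subr_eq0 (tx (Ordinal jn)).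
pose w : R := \prod_(0 <= j < n.+1) (t - x j) ^+ gamma.
have w0 : w != 0.
  rewrite /w big_seq_cond prodf_seq_neq0; apply/allP => j.
  rewrite mem_index_iota ltnS => /= jn; apply/implyP => _.
  by rewrite expf_neq0 // tx0.
have clE i : (i <= n - d)%N ->
    (clambda n d gamma x i).[t] = w * lambda d gamma x i t.
  move=> ind; have idn : (i + d <= n)%N by rewrite addnC -leq_subRL.
  rewrite /clambda /lambda hornerZ horner_prod mulrCA; congr (_ * _).
  under eq_bigr do rewrite horner_exp hornerXsubC.
  rewrite /w [in RHS](bigID (fun j => (i <= j <= i + d)%N)) /= mulrAC.
  rewrite -[LHS]mul1r; congr (_ * _).
  have -> : \prod_(0 <= j < n.+1 | (i <= j <= i + d)%N) (t - x j) ^+ gamma =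
            \prod_(i <= j < (i + d).+1) (t - x j) ^+ gamma :> R.
    rewrite [RHS](big_nat_widen _ _ n.+1) ?ltnS //.
    rewrite [RHS](big_nat_widenl _ 0) //.
    by apply: eq_bigl => j; rewrite ltnS andbC.
  rewrite -big_split big_nat big1 //= => j /andP[_ jd]; rewrite divff //.
  by rewrite expf_neq0 // tx0 // (leq_trans _ idn).
have -> : (gFHden n d gamma x).[t] =
    w * \sum_(0 <= i < (n - d).+1) lambda d gamma x i t.
  rewrite /gFHden horner_sum mulr_sumr.
  by apply: eq_big_nat => i /andP[_]; rewrite ltnS; apply: clE.
have -> : (gFHnum n d gamma x f).[t] = w *
    \sum_(0 <= i < (n - d).+1) lambda d gamma x i t * (interp d x f i).[t].
  rewrite /gFHnum horner_sum mulr_sumr.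
  by apply: eq_big_nat => i /andP[_]; rewrite ltnS hornerM mulrA => /clE ->.
by rewrite -mulf_div divff // mul1r.
Qed.

End FloaterHormann.

(* Main.v *)
(* Write D = sum_i lambda_i, so that f - r = sum_i lambda_i (f - p_i) / D, let
   t lie in the cell (x_al, x_(al+1)), and let M bound the ratio h / h*.  The
   lambda_i with al - d <= i <= al + 1 all have the same sign.  Going away from
   this range on either side, |lambda_i| decreases, in the first step by a factor
   at most M / (M + 1), and the signs are constant or alternate; hence
   |lambda_i| <= (M + 1) |D| for the i in this range.  Comparing
   a farther window, at distance k, with the nearest such i gives a ratio
   r <= min(1, M/k, M^2 (d+1)/k^2) of the products |t - x_i| ... |t - x_(i+d)|,
   and |lambda_i| <= r^gamma (M + 1) |D|.  On the other hand, subtracting the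
   Taylor polynomial of f at t shows that |f - p_i| grows at most like
   r^-1 k^(s-1).  When s < gamma the sum over i is therefore at most a multiple of
   n^-s sum_k k^-2.  When gamma <= s the same bound is applied with gamma - 1 in
   place of s; the logarithm of the case gamma = s + 1 is not needed. *)

Require Import Defs.
From HB Require Import structures.
From mathcomp Require Import all_boot all_order all_algebra.
From mathcomp Require Import all_classical all_reals all_analysis.
From mathcomp Require Import ring lra zify.

Import Order.TTheory GRing.Theory Num.Theory.
Import numFieldNormedType.Exports.

Local Open Scope classical_set_scope.
Local Open Scope ring_scope.

Set Implicit Arguments.
Unset Strict Implicit.
Unset Printing Implicit Defensive.

(** * Taylor expansion with relative derivatives *)

Lemma derivative_on_eps (R : realType) (a b : R) (f g : R -> R) u e :
  derivative_on a b f g -> a <= u <= b -> 0 < e ->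
  exists2 del, 0 < del & forall v, a <= v <= b -> v != u -> `|v - u| < del ->
    `|g u - (f v - f u) / (v - u)| < e.
Proof.
move=> dfg uab e0; have /cvgrPdist_lt/(_ e e0) := dfg u uab.
rewrite /within /dnbhs /within /= => /nbhs_ballP[del /= del0 H].
by exists del => // v vab vu vd; apply: H => //=; rewrite /ball /= distrC.
Qed.

(** Near [u] the difference quotient is within 1 of [g u], so increments of [f] are at most (|g u| +
    1) |v - u|. *)
Lemma derivative_on_continuous (R : realType) (a b : R) (f g : R -> R) :
  derivative_on a b f g -> {within `[a, b], continuous f}.
Proof.
move=> dfg; apply/subspace_continuousP => u /=; rewrite in_itv /= => uab.
apply/cvgrPdist_lt => e e0.
have [del del0 H] := derivative_on_eps dfg uab ltr01.
have g1 : 0 < `|g u| + 1 by rewrite ltr_wpDl.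
apply/nbhs_ballP; exists (Num.min del (e / (`|g u| + 1))) => /=.
  by rewrite lt_min del0 divr_gt0.
move=> v; rewrite /ball /= in_itv /= lt_min distrC => /andP[vd ve] vab.
have [->|vu] := eqVneq v u; first by rewrite subrr normr0.
have vu0 : 0 < `|v - u| by rewrite normr_gt0 subr_eq0.
have := H v vab vu vd; set q := _ / _ => qlt.
have -> : f u - f v = - (q * (v - u)).
  by rewrite /q divfK ?subr_eq0 // opprB.
rewrite normrN normrM (@le_lt_trans _ _ ((`|g u| + 1) * `|v - u|)) //.
  rewrite ler_wpM2r //; have := ler_normB (g u) (g u - q).
  rewrite subKr => /le_trans; apply; rewrite lerD2l; exact: ltW.
by rewrite mulrC -ltr_pdivlMr.
Qed.

(** A small enough neighbourhood of an interior point stays inside [a, b], so the relative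
    derivative is the ordinary one and the mean value theorem becomes applicable. *)
Lemma derivative_on_is_derive (R : realType) (a b : R) (f g : R -> R) u :
  derivative_on a b f g -> a < u < b -> is_derive u 1 f (g u).
Proof.
move=> dfg /andP[au ub].
have uab : a <= u <= b by rewrite !ltW.
have H : h^-1 *: ((f \o shift u) (h *: (1 : R)) - f u) @[h --> (0 : R)^'] --> g u.
  apply/cvgrPdist_lt => e e0.
  have [del del0 H] := derivative_on_eps dfg uab e0.
  rewrite /dnbhs /within /=; apply/nbhs_ballP.
  exists (Num.min del (Num.min (u - a) (b - u))) => /=.
    by rewrite !lt_min del0 !subr_gt0 au.
  move=> h; rewrite /ball /= sub0r normrN !lt_min => /and3P[hd ha hb] h0.
  have hu : h + u - u = h by rewrite addrK.
  have := H (h + u); rewrite hu; rewrite /GRing.scale /= mulr1 mulrC.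
  apply => //.
    move: ha hb; rewrite !ltr_norml => /andP[ha1 _] /andP[_ hb2]; lra.
  by rewrite -subr_eq0 hu.
apply: DeriveDef; first by apply/cvg_ex; exists (g u).
exact: (cvg_lim _ H).
Qed.

Lemma Cs_pred (R : realType) (a b : R) s (f : R -> R) :
  Cs a b s.+1 f -> Cs a b s f.
Proof.
elim: s f => [|s IHs] f [g [dfg gs]]; first exact: derivative_on_continuous dfg.
by exists g; split => //; exact: IHs.
Qed.

Lemma within_itv_bounded (R : realType) (a b : R) (f : R -> R) :
  {within `[a, b], continuous f} ->
  exists2 F, 0 <= F & forall y, a <= y <= b -> `|f y| <= F.
Proof.
move=> fc.
have /compact_bounded[N [_ HN]] := continuous_compact fc (@segment_compact _ a b).
exists (`|N| + 1) => [|y yab]; first by rewrite addr_ge0.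
apply: HN; first by rewrite (le_lt_trans (ler_norm N)) // ltrDl.
by exists y => //=; rewrite in_itv.
Qed.

(** The integration step of the Taylor expansion; the constant term is used to prescribe the value
    at [t]. *)
Lemma poly_antiderivative (R : realType) (p : {poly R}) (c t : R) :
  exists2 q : {poly R}, q^`() = p & q.[t] = c /\ (size q <= (size p).+1)%N.
Proof.
pose q0 : {poly R} := \poly_(i < (size p).+1) (p`_i.-1 / i%:R).
have dq0 : q0^`() = p.
  apply/polyP => i; rewrite coef_deriv coef_poly /= ltnS.
  case: ltnP => [|ip]; last by rewrite mul0rn nth_default.
  by rewrite -[LHS]mulr_natr divfK // pnatr_eq0.
exists (q0 + (c - q0.[t])%:P).
  by rewrite derivD derivC addr0.
split; first by rewrite hornerD hornerC subrKC.
rewrite (leq_trans (size_polyD _ _)) // geq_max size_poly.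
by rewrite (leq_trans (size_polyC_leq1 _)).
Qed.

Lemma mean_value_bound (R : realType) (f df : R -> R) (c d L : R) :
  c <= d -> (forall x, c < x < d -> is_derive x 1 f (df x)) ->
  {within `[c, d], continuous f} -> (forall x, c < x < d -> `|df x| <= L) ->
  `|f d - f c| <= L * (d - c).
Proof.
rewrite le_eqVlt => /predU1P[-> *|cd H fc HL]; first by rewrite !subrr normr0 mulr0.
have H' x : x \in `]c, d[%R -> is_derive x 1 f (df x).
  by rewrite in_itv; exact: H.
have [z] := MVT cd H' fc; rewrite in_itv /= => zcd ->.
rewrite normrM (gtr0_norm (x := d - c)) ?subr_gt0 //.
by rewrite ler_wpM2r ?HL // subr_ge0 ltW.
Qed.

(** Induction on [s]: the polynomial for the derivative [g] is integrated, and the mean value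
    theorem turns the bound on [g - T] into one for the remainder with one more power of |y - t|.
    The same [F] survives every stage and serves every centre [t]. For s > 0 the case y = t of the
    bound gives T.[t] = f t. *)
Lemma Cs_taylor (R : realType) (a b : R) s (f : R -> R) : Cs a b s f ->
  exists2 F, 0 <= F & forall t, a <= t <= b ->
  exists2 T : {poly R}, (size T <= s)%N &
    forall y, a <= y <= b -> `|f y - T.[y]| <= F * `|y - t| ^+ s.
Proof.
elim: s f => [|s IHs] f.
  move=> /within_itv_bounded[F F0 HF]; exists F => // t tab.
  exists 0 => [|y yab]; first by rewrite size_poly0.
  by rewrite horner0 subr0 expr0 mulr1; exact: HF.
case=> g [dfg /IHs[F F0 HF]]; exists F => // t tab.
have [T sT HT] := HF t tab.
have [Q dQ [Qt sQ]] := poly_antiderivative T (f t) t.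
exists Q => [|y yab]; first by rewrite (leq_trans sQ).
pose phi u := f u - Q.[u].
have phid x : a < x < b -> is_derive x 1 phi (g x - T.[x]).
  move=> xab; rewrite -dQ.
  have := derivative_on_is_derive dfg xab => ?.
  have := is_derive_poly Q x => ?.
  exact: is_deriveB.
have phic : {within `[a, b], continuous phi}.
  apply: within_continuousB; first exact: derivative_on_continuous dfg.
  by apply: continuous_subspaceT => x; exact: continuous_horner.
(* Stated for an arbitrary interval [c, d], so that it covers both t <= y and y < t. *)
have key c d : a <= c -> c <= d -> d <= b ->
    (forall x, c < x < d -> `|x - t| <= `|y - t|) ->
    `|phi d - phi c| <= F * `|y - t| ^+ s * (d - c).
  move=> ac cd db H; apply: (mean_value_bound (df := fun x => g x - T.[x])) => //.
  - move=> x /andP[cx xd]; apply: phid.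
    by rewrite (le_lt_trans ac) // (lt_le_trans xd).
  - apply: continuous_subspaceW phic => x /=; rewrite !in_itv /= => /andP[cx xd].
    by rewrite (le_trans ac) // (le_trans xd).
  - move=> x /andP[cx xd]; apply: (le_trans (HT x _)).
      by rewrite (le_trans ac (ltW cx)) // (le_trans (ltW xd)).
    by rewrite ler_wpM2l // lerXn2r ?nnegrE // H // cx.
have -> : f y - Q.[y] = phi y - phi t by rewrite /phi Qt subrr subr0.
case/andP: tab => at_ tb; case/andP: yab => ay yb.
rewrite exprSr mulrA; case: (leP t y) => ty.
  rewrite [X in _ * X]ger0_norm ?subr_ge0 // key // => x /andP[tx xy].
  rewrite !ger0_norm ?subr_ge0 ?(ltW tx) //; lra.
rewrite distrC [X in _ * X]ltr0_norm ?subr_lt0 // [in leRHS]opprB.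
apply: key => //; first exact: ltW.
move=> x /andP[yx xt].
rewrite !ler0_norm ?subr_le0 ?(ltW yx) ?(ltW xt) // ?(ltW ty) //; lra.
Qed.
(** * Alternating sums and sequences with quasi-uniform steps *)

(** Removing the first term leaves c 0 minus a sum of the same kind, which lies between 0 and c 1 <=
    c 0. *)
Lemma alternating_sum_bounds (R : realType) (c : nat -> R) N :
  (forall k, (k < N)%N -> 0 <= c k) ->
  (forall k, (k.+1 < N)%N -> c k.+1 <= c k) ->
  0 <= \sum_(k < N) (-1) ^+ k * c k /\
  ((0 < N)%N -> \sum_(k < N) (-1) ^+ k * c k <= c 0%N).
Proof.
elim: N c => [|N IHN] c c0 cS; first by rewrite big_ord0.
have [|k kN|L U] := IHN (fun k => c k.+1); first by move=> k kN; apply: c0.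
  exact: cS.
rewrite big_ord_recl expr0 mul1r.
under eq_bigr do rewrite /= exprS mulN1r mulNr.
rewrite sumrN; split => [|_]; last by rewrite gerBl.
rewrite subr_ge0; case: N {IHN} c0 cS L U => [|N] c0 cS L U.
  by rewrite big_ord0 c0.
by apply: (le_trans (U _)) => //; exact: cS.
Qed.

(** For even [gamma] no term is negative; for odd [gamma] the terms after the first take away at
    most c 1 <= rho * c 0. *)
Lemma signed_sum_ge (R : realType) (c : nat -> R) N (rho : R) gamma :
  (0 < N)%N -> 0 <= rho ->
  (forall k, (k < N)%N -> 0 <= c k) ->
  (forall k, (k.+1 < N)%N -> c k.+1 <= c k) ->
  ((1 < N)%N -> c 1%N <= rho * c 0%N) ->
  (1 - rho) * c 0%N <= \sum_(k < N) ((-1) ^+ gamma) ^+ k * c k.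
Proof.
case: N => // N _ rho0 c0 cS c1; rewrite big_ord_recl expr0 mul1r.
have rc0 : 0 <= rho * c 0%N by rewrite mulr_ge0 // c0.
rewrite mulrBl mul1r lerD2l -signr_odd; case: (odd gamma) => /=.
  have [|k kN|L U] := @alternating_sum_bounds _ (fun k => c k.+1) N.
  - by move=> k kN; apply: c0.
  - exact: cS.
  rewrite expr1; under eq_bigr do rewrite /= /bump /= add1n exprS mulN1r mulNr.
  rewrite sumrN lerN2; case: N {c0 cS} c1 L U => [|N] c1 L U.
    by rewrite big_ord0.
  by apply: (le_trans (U _)) => //; exact: c1.
apply: (@le_trans _ _ 0); first by rewrite oppr_le0.
by apply: sumr_ge0 => k _; rewrite expr0 expr1n mul1r c0 //= /bump add1n ltnS.
Qed.

Lemma sum_inv_sqr_le2 (R : realType) K :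
  \sum_(k < K) ((k.+1%:R : R) ^+ 2)^-1 <= 2.
Proof.
(* The sharper bound 2 - 1 / (K + 1) makes the induction telescope. *)
suff H : \sum_(k < K.+1) ((k.+1%:R : R) ^+ 2)^-1 <= 2 - K.+1%:R^-1.
  apply: (@le_trans _ _ (2 - K.+1%:R^-1)); last by rewrite gerBl invr_ge0.
  by apply: le_trans H; rewrite big_ord_recr lerDl /= invr_ge0 exprn_ge0.
elim: K => [|K IHK]; first by rewrite big_ord_recr big_ord0 /= expr1n invr1; lra.
rewrite big_ord_recr /=; apply: (le_trans (lerD IHK (lexx _))).
set u : R := K.+1%:R; have u0 : 0 < u by rewrite ltr0n.
have -> : K.+2%:R = u + 1 by rewrite -(natr1 K.+1).
rewrite -subr_ge0.
suff -> : 2 - (u + 1)^-1 - (2 - u^-1 + ((u + 1) ^+ 2)^-1) = (u * (u + 1) ^+ 2)^-1.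
  by rewrite invr_ge0 mulr_ge0 // ?exprn_ge0 // ltW // ltr_wpDr.
by field; lra.
Qed.

Definition natdist (i j : nat) : nat := ((i - j) + (j - i))%N.

Lemma sum_inv_sqr_dist (R : realType) al N :
  \sum_(0 <= i < N) (((natdist i al).+1%:R : R) ^+ 2)^-1 <= 4.
Proof.
have F0 i : 0 <= (((natdist i al).+1%:R : R) ^+ 2)^-1.
  by rewrite invr_ge0 exprn_ge0.
(* The longer range can be split at [al] even when N < al; each of the two sides then contributes at
   most 2. *)
apply: (@le_trans _ _ (\sum_(0 <= i < al + N) (((natdist i al).+1%:R : R) ^+ 2)^-1)).
  rewrite [leRHS](@big_cat_nat _ _ _ N) ?leq_addl //= lerDl.
  by apply: sumr_ge0.
rewrite (@big_cat_nat _ _ _ al) ?leq_addr //=.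
have -> : (4 : R) = 2 + 2 by lra.
apply: lerD.
  rewrite big_nat_rev /= big_mkord.
  apply: le_trans (sum_inv_sqr_le2 R al); apply: ler_sum => i _.
  have -> : natdist (0 + al - i.+1) al = i.+1.
    by rewrite /natdist; have := ltn_ord i; lia.
  by rewrite lef_pV2 ?posrE ?exprn_gt0 ?ltr0n // lerXn2r ?nnegrE // ler_nat.
rewrite -{1}[al]add0n big_addn big_mkord addKn.
apply: le_trans (sum_inv_sqr_le2 R N); apply: ler_sum => i _.
have -> // : natdist (i + al) al = i by rewrite /natdist; lia.
Qed.

(** * Products of consecutive distances with quasi-uniform increments *)

Section Steps.
Variables (R : realType) (M delta : R) (N : nat) (e : nat -> R).
Hypotheses (M1 : 1 <= M) (delta0 : 0 < delta) (e00 : 0 < e 0%N)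
  (e0M : e 0%N <= M * delta)
  (eS : forall l, (l.+1 < N)%N -> e l + delta <= e l.+1 <= e l + M * delta).

Lemma steps_ge l k : (l + k < N)%N -> e l + k%:R * delta <= e (l + k)%N.
Proof.
elim: k => [|k IHk] lk; first by rewrite mul0r addr0 addn0.
rewrite addnS in lk *; have /andP[H _] := eS lk.
apply: le_trans H; rewrite -natr1 mulrDl mul1r addrA lerD2r.
by apply: IHk; exact: ltnW.
Qed.

Lemma steps_gt0 l : (l < N)%N -> 0 < e l.
Proof.
move=> lN; have := @steps_ge 0 l; rewrite add0n => /(_ lN); apply: lt_le_trans.
by rewrite ltr_wpDr // mulr_ge0 // ltW.
Qed.

Lemma steps_le l : (l < N)%N -> e l <= l.+1%:R * (M * delta).
Proof.
elim: l => [|l IHl] lN; first by rewrite mul1r.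
have /andP[_ H] := eS lN; apply: (le_trans H).
by rewrite -natr1 mulrDl mul1r lerD2r IHl // ltnW.
Qed.

Lemma steps_prod_le p : (p <= N)%N ->
  \prod_(l < p) e l <= (p`!)%:R * (M * delta) ^+ p.
Proof.
elim: p => [|p IHp] pN; first by rewrite big_ord0 mul1r.
rewrite big_ord_recr /= factS natrM exprS.
have -> : p.+1%:R * p`!%:R * (M * delta * (M * delta) ^+ p) =
  (p`!%:R * (M * delta) ^+ p) * (p.+1%:R * (M * delta)) by ring.
apply: ler_pM; [|exact/ltW/steps_gt0|exact/IHp/ltnW|exact: steps_le].
by apply: prodr_ge0 => l _; apply/ltW/steps_gt0/(ltn_trans (ltn_ord l)).
Qed.

(** With [e] the distances from t to the nodes on one side, this is the absolute product of the t -
    x_j over d + 1 consecutive nodes, [k] places away from the cell. *)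
Definition window d k : R := \prod_(l < d.+1) e (k + l)%N.

Lemma window_gt0 d k : (k + d < N)%N -> 0 < window d k.
Proof.
move=> kdN; apply: prodr_gt0 => l _; apply: steps_gt0.
by have := ltn_ord l; lia.
Qed.

Lemma window_le d k : (k.+1 + d < N)%N -> window d k <= window d k.+1.
Proof.
move=> kdN; apply: ler_prod => l _; have := ltn_ord l => ld.
have kN : ((k + l).+1 < N)%N by lia.
have /andP[H _] := eS kN; have H0 := steps_gt0 (ltnW kN).
by rewrite addSn; apply/andP; split; [exact: ltW|apply: le_trans H; rewrite lerDl ltW].
Qed.

Lemma quot_ge0_le1 d k l : (k + d < N)%N -> (l <= d)%N ->
  0 <= e l / e (k + l)%N <= 1.
Proof.
move=> kdN ld; have lN : (l + k < N)%N by lia.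
have el := steps_gt0 (leq_ltn_trans (leq_addr k l) lN).
have ekl := steps_gt0 lN.
rewrite addnC divr_ge0 ?(ltW el) ?(ltW ekl) //= ler_pdivrMr // mul1r.
by apply: le_trans (steps_ge lN); rewrite lerDl mulr_ge0 // ltW.
Qed.

(** The numerator is at most (l + 1) M delta and the denominator at least k delta, so the mesh size
    cancels. *)
Lemma quot_le d k l : (k + d < N)%N -> (l <= d)%N -> (0 < k)%N ->
  e l / e (k + l)%N <= l.+1%:R * M / k%:R.
Proof.
move=> kdN ld k0; have lN : (l + k < N)%N by lia.
have kR : 0 < (k%:R : R) by rewrite ltr0n.
rewrite addnC ler_pdivrMr ?steps_gt0 // mulrAC ler_pdivlMr //.
apply: (@le_trans _ _ (l.+1%:R * (M * delta) * k%:R)).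
  by rewrite ler_wpM2r // steps_le // (leq_ltn_trans _ lN) ?leq_addr.
have -> : l.+1%:R * (M * delta) * k%:R = l.+1%:R * M * (k%:R * delta) by ring.
rewrite ler_wpM2l //; first by rewrite mulr_ge0 ?ler0n // (le_trans ler01 M1).
apply: le_trans (steps_ge lN); rewrite lerDr ltW // steps_gt0 //.
by rewrite (leq_ltn_trans _ lN) ?leq_addr.
Qed.

Lemma window_ratioE d k :
  window d 0 / window d k = \prod_(l < d.+1) (e l / e (k + l)%N).
Proof. by rewrite /window -prodf_div. Qed.

Lemma window_ratio_le_head d k : (k + d < N)%N ->
  window d 0 / window d k <= e 0%N / e k.
Proof.
move=> kdN; rewrite window_ratioE big_ord_recl /= addn0 ler_piMr //.
  by have /andP[] := @quot_ge0_le1 d k 0 kdN (leq0n _); rewrite addn0.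
apply: prodr_ile1 => l _; apply: quot_ge0_le1 kdN _.
by rewrite /= /bump /= add1n.
Qed.

Lemma window0_le d k : (k + d < N)%N -> window d 0 <= window d k.
Proof.
move=> kdN; rewrite -[leRHS]mul1r -ler_pdivrMr ?window_gt0 //.
apply: (le_trans (window_ratio_le_head kdN)).
by have /andP[] := quot_ge0_le1 kdN (leq0n d); rewrite addn0.
Qed.

Lemma window_ratio_le d k : (0 < k)%N -> (k + d < N)%N ->
  window d 0 / window d k <= M / k%:R.
Proof.
move=> k0 kdN; apply: (le_trans (window_ratio_le_head kdN)).
by have := quot_le kdN (leq0n d) k0; rewrite addn0 mul1r.
Qed.

(** The quotient e 0 / e 1 is at most e 0 / (e 0 + delta), which increases with e 0 <= M delta.
    Staying uniformly below 1 prevents the second term of an alternating sum from cancelling the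
    first. *)
Lemma window_ratio_le_const d : (1 + d < N)%N ->
  window d 0 / window d 1 <= M / (M + 1).
Proof.
move=> dN; apply: (le_trans (window_ratio_le_head dN)).
have N1 : (1 < N)%N by lia.
have := @steps_ge 0 1 N1; rewrite add0n mul1r => H.
have e1 := steps_gt0 N1; have M0 := lt_le_trans ltr01 M1.
rewrite ler_pdivrMr // mulrAC ler_pdivlMr; last by rewrite ltr_wpDr.
apply: (@le_trans _ _ (M * (e 0%N + delta))); last by rewrite ler_wpM2l // ltW.
by rewrite !mulrDr mulr1 [e 0%N * M]mulrC lerD2l.
Qed.

(** Both the first and the last factor of the ratio are kept, each of order 1 / k; they are distinct
    because d > 0. The resulting k^-2 is what makes the final sum bounded. *)
Lemma window_ratio_le_sqr d k : (0 < d)%N -> (0 < k)%N -> (k + d < N)%N ->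
  window d 0 / window d k <= M ^+ 2 * d.+1%:R / k%:R ^+ 2.
Proof.
case: d => // d _ k0 kdN; rewrite window_ratioE big_ord_recl big_ord_recr /=.
rewrite addn0 mulrA.
have h0 := quot_le kdN (leq0n _) k0; rewrite addn0 mul1r in h0.
have /andP[g0 _] := quot_ge0_le1 kdN (leq0n _); rewrite addn0 in g0.
have hd := quot_le kdN (leqnn _) k0.
have /andP[gd _] := quot_ge0_le1 kdN (leqnn _).
have -> : M ^+ 2 * d.+2%:R / k%:R ^+ 2 = (M / k%:R) * (d.+2%:R * M / k%:R).
  by field; rewrite pnatr_eq0 -lt0n.
rewrite /bump /= add1n; apply: ler_pM => //.
  rewrite mulr_ge0 // prodr_ge0 // => l _.
  rewrite /bump /= add1n; have ld : (l.+1 <= d.+1)%N by have := ltn_ord l; lia.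
  by have /andP[] := quot_ge0_le1 kdN ld.
apply: le_trans h0; rewrite ler_piMr // prodr_ile1 // => l _.
rewrite /bump /= add1n; apply: quot_ge0_le1 kdN _.
by have := ltn_ord l; lia.
Qed.

(** This is [signed_sum_ge] with rho = M / (M + 1), whence the factor 1 - rho = 1 / (M + 1). *)
Lemma signed_window_sum_ge d gamma : (0 < gamma)%N -> (d < N)%N ->
  (M + 1)^-1 * window d 0 ^- gamma <=
    \sum_(k < N - d) ((-1) ^+ gamma) ^+ k * window d k ^- gamma.
Proof.
move=> gamma0 dN; have M0 := lt_le_trans ltr01 M1.
have M10 : 0 < M + 1 by rewrite ltr_wpDr.
have -> : (M + 1)^-1 = 1 - M / (M + 1) by field; rewrite gt_eqF.
apply: (signed_sum_ge (c := fun k => window d k ^- gamma)).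
- by rewrite subn_gt0.
- by rewrite divr_ge0 // ltW.
- by move=> k kN; rewrite invr_ge0 exprn_ge0 // ltW // window_gt0; lia.
- move=> k kN; have kN' : (k.+1 + d < N)%N by lia.
  have w0 : 0 < window d k by rewrite window_gt0; lia.
  have w1 := window_gt0 kN'.
  by rewrite lef_pV2 ?posrE ?exprn_gt0 // lerXn2r ?nnegrE ?(ltW w0) ?(ltW w1) // window_le.
- move=> dN1; have dN' : (1 + d < N)%N by lia.
  have w0 : 0 < window d 0 by rewrite window_gt0.
  have w1 := window_gt0 dN'.
  have H := window_ratio_le_const dN'.
  rewrite -ler_pdivrMr ?invr_gt0 ?exprn_gt0 // invrK mulrC -expr_div_n.
  (* The ratio is at most 1, so its power with exponent [gamma] >= 1 is bounded by the ratio
     itself. *)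
  case: gamma gamma0 => // g _; rewrite exprS; apply: le_trans H.
  rewrite ler_piMr ?exprn_ile1 ?divr_ge0 ?(ltW w0) ?(ltW w1) //.
  by rewrite ler_pdivrMr // mul1r window_le.
Qed.

Lemma signed_window_sum_ge0 d gamma : (0 < gamma)%N ->
  0 <= \sum_(k < N - d) ((-1) ^+ gamma) ^+ k * window d k ^- gamma.
Proof.
move=> gamma0; case: (ltnP d N) => dN.
  apply: le_trans (signed_window_sum_ge gamma0 dN).
  rewrite mulr_ge0 ?invr_ge0 ?exprn_ge0 // ?(ltW (@window_gt0 d 0 _)) //.
  by rewrite addr_ge0 // (le_trans ler01).
have -> : (N - d)%N = 0%N by lia.
by rewrite big_ord0.
Qed.

End Steps.
(** * The interpolation error *)

Lemma natr_dist_le (R : realType) (x : nat -> R) (delta : R) n j q :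
  (forall k, (k < n)%N -> delta <= x k.+1 - x k) -> (j + q <= n)%N ->
  q%:R * delta <= x (j + q)%N - x j.
Proof.
move=> gap; elim: q => [|q IHq] jqn; first by rewrite addn0 subrr mul0r.
rewrite addnS in jqn *; have := gap _ jqn; have := IHq (ltnW jqn).
by rewrite -natr1 mulrDl mul1r; lra.
Qed.

Lemma prod_dist_below (R : realType) (x : nat -> R) (delta : R) n i q :
  0 <= delta -> (forall k, (k < n)%N -> delta <= x k.+1 - x k) ->
  (i + q <= n)%N ->
  q`!%:R * delta ^+ q <= \prod_(i <= k < i + q) `|x (i + q)%N - x k|.
Proof.
move=> delta0 gap; elim: q i => [|q IHq] i iqn.
  by rewrite addn0 big_geq // mulr1.
rewrite big_ltn ?addnS ?ltnS ?leq_addr // -addSn factS natrM exprS.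
rewrite -addSnnS in iqn; rewrite mulrACA; apply: ler_pM.
- by rewrite mulr_ge0.
- by rewrite mulr_ge0 ?exprn_ge0.
- have := @natr_dist_le _ _ _ n i q.+1 gap.
  rewrite addnS -addSn => /(_ iqn) H.
  exact: le_trans H (ler_norm _).
- exact: IHq.
Qed.

Lemma prod_dist_above (R : realType) (x : nat -> R) (delta : R) n j q :
  0 <= delta -> (forall k, (k < n)%N -> delta <= x k.+1 - x k) ->
  (j + q <= n)%N ->
  q`!%:R * delta ^+ q <= \prod_(j.+1 <= k < (j + q).+1) `|x j - x k|.
Proof.
move=> delta0 gap; elim: q => [|q IHq] jqn.
  by rewrite addn0 big_geq // mulr1.
rewrite addnS big_nat_recr ?ltnS ?leq_addr //= factS natrM exprSr.
rewrite [q.+1%:R * _]mulrC mulrACA; apply: ler_pM.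
- by rewrite mulr_ge0 ?exprn_ge0.
- by rewrite mulr_ge0.
- by apply: IHq; rewrite addnS in jqn; exact: ltnW.
- rewrite distrC -addnS; apply: le_trans (ler_norm _).
  exact: natr_dist_le gap jqn.
Qed.

(** The nodes before and after x j contribute (j - i)! and (i + d - j)!. Their product is at least
    d! / 2^d, since a binomial coefficient is at most 2^d. *)
Lemma prod_dist_ge (R : realType) (x : nat -> R) (delta : R) n d i j :
  0 <= delta -> (forall k, (k < n)%N -> delta <= x k.+1 - x k) ->
  (i + d <= n)%N -> (i <= j <= i + d)%N ->
  d`!%:R * delta ^+ d / 2 ^+ d <=
    \prod_(i <= k < (i + d).+1 | k != j) `|x j - x k|.
Proof.
move=> delta0 gap idn /andP[ij jid].
rewrite (@big_cat_nat _ _ _ j) ?leqW //= [X in _ <= _ * X]big_ltn_cond ?ltnS // eqxx /=.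
rewrite big_nat_cond (eq_bigl (fun k => (i <= k < j)%N)); last first.
  by move=> k; case: (ltngtP k j); rewrite ?andbF ?andbT.
rewrite -big_nat [X in _ <= _ * X]big_nat_cond.
rewrite [X in _ <= _ * X](eq_bigl (fun k => (j.+1 <= k < (i + d).+1)%N)); last first.
  by move=> k; case: (ltngtP j k); rewrite ?andbF ?andbT.
rewrite -[X in _ <= _ * X]big_nat.
have jE : j = (i + (j - i))%N by lia.
have := @prod_dist_below _ x delta n i (j - i) delta0 gap.
rewrite -jE => /(_ (leq_trans jid idn)) B.
have := @prod_dist_above _ x delta n j (i + d - j) delta0 gap.
rewrite subnKC // => /(_ idn) A.
have dE : (i + d - j = d - (j - i))%N by lia.
have jid' : (j - i <= d)%N by lia.
rewrite dE in A; apply: le_trans (ler_pM _ _ B A); last 2 first.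
- by rewrite mulr_ge0 ?exprn_ge0.
- by rewrite mulr_ge0 ?exprn_ge0.
rewrite mulrACA -exprD subnKC // [leLHS]mulrAC ler_wpM2r ?exprn_ge0 //.
rewrite ler_pdivrMr ?exprn_gt0 // -natrX -!natrM ler_nat -(bin_fact jid') mulnC.
rewrite leq_mul2l; apply/orP; right.
have := expnDn 1 1 d; rewrite addn1 => ->.
by rewrite (bigD1 (inord (j - i))) //= inordK ?ltnS // !exp1n !muln1 leq_addr.
Qed.

Lemma horner_interpE (R : realType) d (x : nat -> R) (f : R -> R) i t :
  (interp d x f i).[t] = \sum_(i <= j < (i + d).+1)
    f (x j) * \prod_(i <= k < (i + d).+1 | k != j) ((t - x k) / (x j - x k)).
Proof.
rewrite /interp horner_sum; apply: eq_bigr => j _.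
rewrite hornerZ horner_prod; congr (_ * _); apply: eq_bigr => k _.
by rewrite !hornerE mulrC.
Qed.

(* p_i reproduces the Taylor polynomial T at t, so that
   p_i(t) - f(t) = sum_j (f - T)(x_j) l_j(t) for the Lagrange basis l_j. *)
Lemma interp_error (R : realType) (f : R -> R) (x : nat -> R) (T : {poly R})
    (F delta L t : R) n d s i :
  0 <= F -> 0 < delta -> (forall k, (k < n)%N -> delta <= x k.+1 - x k) ->
  (i + d <= n)%N -> (s <= d)%N ->
  (size T <= s.+1)%N -> T.[t] = f t ->
  (forall j, (j <= n)%N -> `|f (x j) - T.[x j]| <= F * `|x j - t| ^+ s.+1) ->
  (forall j, (i <= j <= i + d)%N -> `|t - x j| <= L) ->
  `|f t - (interp d x f i).[t]| <=
    F * (\prod_(i <= j < (i + d).+1) `|t - x j|) * d.+1%:R * L ^+ s *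
    (2 ^+ d / (d`!%:R * delta ^+ d)).
Proof.
move=> F0 delta0 gap idn sd sT Tt HT HL.
have dx : distinct_nodes d x i.
  have lt j k : (i <= j <= i + d)%N -> (i <= k <= i + d)%N -> (j < k)%N -> x j < x k.
    move=> jid kid jk; have := @natr_dist_le _ x _ n j (k - j) gap.
    have kn : (k <= n)%N by lia.
    rewrite subnKC ?(ltnW jk) // => /(_ kn) H; rewrite -subr_gt0.
    by apply: lt_le_trans H; rewrite mulr_gt0 // ltr0n subn_gt0.
  move=> j k jid kid; rewrite neq_ltn => /orP[] jk.
    by rewrite lt_eqF // lt.
  by rewrite gt_eqF // lt.
have TE : T = interp d x (fun y => T.[y]) i.
  by apply: interp_uniq => //; apply: leq_trans sT _.
rewrite distrC -Tt [in X in _ - X]TE !horner_interpE -sumrB.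
(* The bound is spread evenly over the d + 1 nodes, to be compared term by term. *)
have -> : F * (\prod_(i <= j < (i + d).+1) `|t - x j|) * d.+1%:R * L ^+ s *
    (2 ^+ d / (d`!%:R * delta ^+ d)) =
  \sum_(i <= j < (i + d).+1) F * (L ^+ s *
   ((\prod_(i <= j < (i + d).+1) `|t - x j|) * (2 ^+ d / (d`!%:R * delta ^+ d)))).
  rewrite sumr_const_nat subSn ?leq_addr // addKn -mulr_natr; ring.
apply: (le_trans (ler_norm_sum _ _ _)); apply: ler_sum_nat => j jid.
rewrite ltnS in jid; rewrite -mulrBl normrM normr_prod.
have jn : (j <= n)%N by case/andP: jid => _ /leq_trans; apply.
apply: (@le_trans _ _ (F * `|x j - t| ^+ s.+1 *
   \prod_(i <= k < (i + d).+1 | k != j) `|(t - x k) / (x j - x k)|)).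
  by rewrite ler_wpM2r ?prodr_ge0 // HT.
(* Of the s + 1 factors |x j - t|, [s] are bounded by [L]; the last one completes the product over k
   != j to the whole window. *)
rewrite -mulrA ler_wpM2l // exprSr -mulrA.
have L0 : 0 <= L := le_trans (normr_ge0 _) (HL _ jid).
apply: ler_pM; first by rewrite exprn_ge0.
- by rewrite mulr_ge0 ?prodr_ge0.
- by rewrite lerXn2r ?nnegrE // distrC HL.
under eq_bigr do rewrite normrM normfV.
rewrite prodf_div mulrA distrC.
have -> : `|t - x j| * \prod_(i <= k < (i + d).+1 | k != j) `|t - x k| =
    \prod_(i <= j < (i + d).+1) `|t - x j|.
  by rewrite [RHS](bigD1_seq j) ?iota_uniq ?mem_index_iota.
rewrite ler_wpM2l ?prodr_ge0 //.
have c0 : 0 < d`!%:R * delta ^+ d / 2 ^+ d.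
  by rewrite divr_gt0 ?mulr_gt0 ?exprn_gt0 // ltr0n fact_gt0.
have H := prod_dist_ge (ltW delta0) gap idn jid.
rewrite -[leRHS]invf_div lef_pV2 ?posrE //.
exact: lt_le_trans H.
Qed.
(** * Estimates inside one cell of the grid *)

Lemma eq_signr_odd (R : realType) p q : odd p = odd q ->
  (-1) ^+ p = (-1) ^+ q :> R.
Proof. by move=> pq; rewrite -signr_odd pq signr_odd. Qed.

Section Cell.
Variables (R : realType) (M delta t : R) (n d gamma al : nat) (x : nat -> R).
Hypotheses (M1 : 1 <= M) (delta0 : 0 < delta)
  (gap : forall k, (k < n)%N -> delta <= x k.+1 - x k <= M * delta)
  (aln : (al < n)%N) (tal : x al < t < x al.+1)
  (d0 : (0 < d)%N) (dn : (d <= n)%N) (gamma0 : (0 < gamma)%N).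

(* The distances from t to the nodes, going away from the cell containing t. *)
Definition lsteps l : R := t - x (al - l)%N.
Definition rsteps l : R := x (al.+1 + l)%N - t.

Lemma lsteps0 : 0 < lsteps 0.
Proof. by rewrite /lsteps subn0 subr_gt0; case/andP: tal. Qed.

Lemma lsteps0_le : lsteps 0 <= M * delta.
Proof.
rewrite /lsteps subn0; have := gap aln; move: tal => /andP[? ?] /andP[_]; lra.
Qed.

Lemma rsteps0 : 0 < rsteps 0.
Proof. by rewrite /rsteps addn0 subr_gt0; case/andP: tal. Qed.

Lemma rsteps0_le : rsteps 0 <= M * delta.
Proof.
rewrite /rsteps addn0; have := gap aln; move: tal => /andP[? ?] /andP[_]; lra.
Qed.

Lemma lstepsS l : (l.+1 < al.+1)%N ->
  lsteps l + delta <= lsteps l.+1 <= lsteps l + M * delta.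
Proof.
rewrite ltnS => lal; have kn : (al - l.+1 < n)%N by lia.
have := gap kn; have -> : (al - l.+1).+1 = (al - l)%N by lia.
by rewrite /lsteps => /andP[? ?]; apply/andP; split; lra.
Qed.

Lemma rstepsS l : (l.+1 < n - al)%N ->
  rsteps l + delta <= rsteps l.+1 <= rsteps l + M * delta.
Proof.
move=> lal; have kn : (al.+1 + l < n)%N by lia.
have := gap kn; rewrite /rsteps addnS.
by move=> /andP[? ?]; apply/andP; split; lra.
Qed.

(** Its power with exponent -gamma is |lambda_i|; see [norm_lambda]. *)
Definition wdist i : R := \prod_(i <= j < (i + d).+1) `|t - x j|.

Lemma node_left j : (j <= al)%N -> t - x j = lsteps (al - j) /\ 0 < t - x j.
Proof.
move=> jal; have -> : t - x j = lsteps (al - j) by rewrite /lsteps subKn.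
split => //; apply: (steps_gt0 delta0 lsteps0 lstepsS); lia.
Qed.

Lemma node_right j : (al < j)%N -> (j <= n)%N ->
  x j - t = rsteps (j - al.+1) /\ t - x j < 0.
Proof.
move=> alj jn; have E : x j - t = rsteps (j - al.+1) by rewrite /rsteps subnKC.
split => //; rewrite -oppr_gt0 opprB E.
apply: (steps_gt0 delta0 rsteps0 rstepsS); lia.
Qed.

Lemma node_neq0 j : (j <= n)%N -> 0 < `|t - x j|.
Proof.
move=> jn; rewrite normr_gt0; case: (leqP j al) => [/node_left[_]|alj].
  by move/gt_eqF => ->.
by have [_ /lt_eqF ->] := node_right alj jn.
Qed.

Lemma wdist_gt0 i : (i + d <= n)%N -> 0 < wdist i.
Proof.
move=> idn; rewrite /wdist big_nat; apply: prodr_gt0 => j /andP[_ jid].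
by apply: node_neq0; lia.
Qed.

(** Windows on the left are counted outwards from the cell, hence the reversal: index 0 is the
    window whose last node is x al. *)
Lemma wdist_left i : (i + d <= al)%N -> wdist i = window lsteps d (al - d - i).
Proof.
move=> idal; rewrite /wdist big_nat_rev -{1}[i]add0n big_addn big_mkord.
have -> : ((i + d).+1 - i = d.+1)%N by lia.
apply: eq_bigr => l _; have := ltn_ord l => ld.
have -> : (i + (i + d).+1 - (l + i).+1 = i + d - l)%N by lia.
have jal : (i + d - l <= al)%N by lia.
have [-> p] := node_left jal.
have -> : (al - (i + d - l) = al - d - i + l)%N by lia.
rewrite gtr0_norm //; apply: (steps_gt0 delta0 lsteps0 lstepsS); lia.
Qed.

Lemma wdist_right i : (al < i)%N -> (i + d <= n)%N ->
  wdist i = window rsteps d (i - al.+1).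
Proof.
move=> ali idn; rewrite /wdist -{1}[i]add0n big_addn big_mkord.
have -> : ((i + d).+1 - i = d.+1)%N by lia.
apply: eq_bigr => l _; have := ltn_ord l => ld.
have jal : (al < l + i)%N by lia.
have jn : (l + i <= n)%N by lia.
have [E p] := node_right jal jn; rewrite ltr0_norm // opprB E; congr (rsteps _).
by lia.
Qed.

(** The windows that contain at least one endpoint of the cell. *)
Definition near_window i := [&& (i <= al.+1)%N, (al <= i + d)%N & (i + d <= n)%N].

(** With p nodes of the window left of t and q right of it, p + q = d + 1, the two sides give p! and
    q!, and p! q! <= (p + q)!. *)
Lemma wdist_near i : near_window i ->
  wdist i <= d.+1`!%:R * (M * delta) ^+ d.+1.
Proof.
case/and3P => ial alid idn.
rewrite /wdist (@big_cat_nat _ _ _ al.+1) ?ltnS //=.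
have -> : \prod_(i <= j < al.+1) `|t - x j| = \prod_(l < al.+1 - i) lsteps l.
  rewrite big_nat_rev -{1}[i]add0n big_addn big_mkord; apply: eq_bigr => l _.
  have := ltn_ord l => lp.
  have -> : (i + al.+1 - (l + i).+1 = al - l)%N by lia.
  have [-> p] := node_left (leq_subr l al); rewrite subKn; last by lia.
  by rewrite gtr0_norm //; apply: (steps_gt0 delta0 lsteps0 lstepsS); lia.
have -> : \prod_(al.+1 <= j < (i + d).+1) `|t - x j| =
    \prod_(l < i + d - al) rsteps l.
  rewrite -{1}[al.+1]add0n big_addn big_mkord subSS; apply: eq_bigr => l _.
  have := ltn_ord l => lp.
  have jal : (al < l + al.+1)%N by lia.
  have jn : (l + al.+1 <= n)%N by lia.
  have [E p] := node_right jal jn; rewrite ltr0_norm // opprB E addnK //.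
have HL := @steps_prod_le _ M delta al.+1 lsteps delta0 lsteps0 lsteps0_le
  lstepsS (al.+1 - i) (leq_subr _ _).
have pR : (i + d - al <= n - al)%N by lia.
have HR := @steps_prod_le _ M delta (n - al) rsteps delta0 rsteps0 rsteps0_le
  rstepsS _ pR.
apply: (le_trans (ler_pM _ _ HL HR)).
- apply: prodr_ge0 => l _; have := ltn_ord l => lp.
  apply/ltW/(steps_gt0 delta0 lsteps0 lstepsS); lia.
- apply: prodr_ge0 => l _; have := ltn_ord l => lp.
  apply/ltW/(steps_gt0 delta0 rsteps0 rstepsS); lia.
have Md : 0 <= M * delta by rewrite mulr_ge0 ?(ltW delta0) ?(le_trans ler01).
have E : (al.+1 - i + (i + d - al) = d.+1)%N by lia.
rewrite mulrACA -exprD E ler_wpM2r ?exprn_ge0 // -natrM ler_nat.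
have <- : ('C(d.+1, al.+1 - i) * ((al.+1 - i)`! * (d.+1 - (al.+1 - i))`!))%N = d.+1`!.
  by rewrite bin_fact //; lia.
have -> : (d.+1 - (al.+1 - i) = i + d - al)%N by lia.
by rewrite leq_pmull // bin_gt0; lia.
Qed.

(** * Signs of the weights and lower bounds for the denominator *)

Local Notation lam i := (lambda d gamma x i t).

(** In its uses [q] is the number of nodes of the window lying to the right of t, that is, of
    negative factors. *)
Lemma lambda_signE i q : (i + d <= n)%N ->
  \prod_(i <= j < (i + d).+1) (t - x j) = (-1) ^+ q * wdist i ->
  lam i = ((-1) ^+ (i + q)) ^+ gamma * wdist i ^- gamma.
Proof.
move=> idn E; rewrite /lambda exprM prodfV prodrXl E exprMn invfM.
by rewrite -[X in _ * (X * _)]exprVn invr_sign exprD exprMn mulrA.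
Qed.

(* The common sign of the lambda_i with al - d <= i <= al + 1. *)
Definition sgn_den : R := ((-1) ^+ (al + d)) ^+ gamma.

Lemma lambda_left i : (i + d <= al)%N ->
  sgn_den * lam i = ((-1) ^+ gamma) ^+ (al - d - i) * wdist i ^- gamma.
Proof.
move=> idal; rewrite (@lambda_signE i 0) ?(leq_trans idal (ltnW aln)) //; last first.
  rewrite mul1r; rewrite /wdist !big_nat; apply: eq_bigr => j jid.
  have jal : (j <= al)%N by lia.
  by have [_ p] := node_left jal; rewrite gtr0_norm.
rewrite /sgn_den mulrA -exprMn -exprD -!exprM; congr (_ * _).
by apply: eq_signr_odd; rewrite !oddM andbC; congr (_ && _); lia.
Qed.

Lemma lambda_right i : (al < i)%N -> (i + d <= n)%N ->
  sgn_den * lam i = ((-1) ^+ gamma) ^+ (i - al.+1) * wdist i ^- gamma.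
Proof.
move=> ali idn; rewrite (@lambda_signE i d.+1) //; last first.
  have -> : (-1) ^+ d.+1 = \prod_(i <= j < (i + d).+1) (-1 : R).
    by rewrite prodr_const_nat; congr (_ ^+ _); lia.
  rewrite /wdist -big_split !big_nat /=; apply: eq_bigr => j jid.
  have jal : (al < j)%N by lia.
  have jn : (j <= n)%N by lia.
  by have [_ p] := node_right jal jn; rewrite ltr0_norm // mulN1r opprK.
rewrite /sgn_den mulrA -exprMn -exprD -!exprM; congr (_ * _).
by apply: eq_signr_odd; rewrite !oddM andbC; congr (_ && _); lia.
Qed.

(** Shifting a straddling window by one node changes the parity of both [i] and the number of
    negative factors, so the sign is preserved. *)
Lemma lambda_mid i : (i <= al)%N -> (al <= i + d)%N -> (i + d <= n)%N ->
  sgn_den * lam i = wdist i ^- gamma.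
Proof.
move=> ial alid idn; rewrite (@lambda_signE i (i + d - al)) //; last first.
  rewrite /wdist [LHS](@big_cat_nat _ _ _ al.+1) ?ltnS // ?leqW //=.
  rewrite [in RHS](@big_cat_nat _ _ _ al.+1 i) ?ltnS // ?leqW //=.
  have -> : (-1) ^+ (i + d - al) = \prod_(al.+1 <= j < (i + d).+1) (-1 : R).
    by rewrite prodr_const_nat subSS.
  rewrite mulrCA -big_split !big_nat /=; congr (_ * _); apply: eq_bigr => j jid.
    have jal : (j <= al)%N by lia.
    by have [_ p] := node_left jal; rewrite gtr0_norm.
  have jal : (al < j)%N by lia.
  have jn : (j <= n)%N by lia.
  by have [_ p] := node_right jal jn; rewrite ltr0_norm // mulN1r opprK.
rewrite /sgn_den mulrA -exprMn -exprD -[RHS]mul1r; congr (_ * _).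
rewrite -signr_odd; have -> : odd (al + d + (i + (i + d - al))) = false by lia.
by rewrite expr1n.
Qed.

Lemma norm_lambda i : (i + d <= n)%N -> `|lam i| = wdist i ^- gamma.
Proof.
move=> idn; rewrite /lambda normrM normr_sign mul1r prodfV prodrXl normfV normrX.
by rewrite normr_prod.
Qed.

Definition den : R := \sum_(0 <= i < (n - d).+1) lam i.

(** The three groups are the windows left of t, straddling t, and right of t. Both outer sums start
    next to the cell. Truncated subtraction and [minn] account for groups that are empty near the
    ends of the grid. *)
Lemma den_split : sgn_den * den =
  \sum_(k < al.+1 - d) ((-1) ^+ gamma) ^+ k * window lsteps d k ^- gamma
  + \sum_(al.+1 - d <= i < minn al.+1 (n - d).+1) wdist i ^- gamma
  + \sum_(k < n - al - d) ((-1) ^+ gamma) ^+ k * window rsteps d k ^- gamma.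
Proof.
rewrite /den (@big_cat_nat _ _ _ (minn al.+1 (n - d).+1)) ?geq_minr //=.
rewrite (@big_cat_nat _ _ _ (al.+1 - d)) //=; last by lia.
rewrite !mulrDr !mulr_sumr; congr (_ + _ + _).
- rewrite big_nat_rev big_mkord; apply: eq_bigr => k _ /=.
  have := ltn_ord k => kp; have idal : (0 + (al.+1 - d) - k.+1 + d <= al)%N by lia.
  rewrite lambda_left // wdist_left //.
  by have -> : (al - d - (0 + (al.+1 - d) - k.+1) = k)%N by lia.
- rewrite !big_nat; apply: eq_bigr => i ipq; apply: lambda_mid; lia.
have -> : \sum_(minn al.+1 (n - d).+1 <= i < (n - d).+1) sgn_den * lam i =
    \sum_(al.+1 <= i < (n - d).+1) sgn_den * lam i.
  case: (leqP al.+1 (n - d).+1) => [//|h].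
  by rewrite !big_geq // ltnW.
rewrite -{1}[al.+1]add0n big_addn big_mkord.
have -> : ((n - d).+1 - al.+1 = n - al - d)%N by lia.
apply: eq_bigr => k _; have := ltn_ord k => kp.
by rewrite lambda_right ?wdist_right ?addnK //; lia.
Qed.

(** No group of [den_split] is negative, so one dominating group suffices: the right one if i = al +
    1, the left one if i + d = al, and otherwise the middle one, whose terms are all positive. *)
Lemma lambda_near_le i : near_window i ->
  wdist i ^- gamma <= (M + 1) * (sgn_den * den).
Proof.
move=> /and3P[ial alid idn].
have M10 : 0 < M + 1 by rewrite ltr_wpDl // (le_trans ler01).
rewrite -ler_pdivrMl // den_split.
have L0 := signed_window_sum_ge0 M1 delta0 lsteps0 lsteps0_le lstepsS d gamma0.
have R0 := signed_window_sum_ge0 M1 delta0 rsteps0 rsteps0_le rstepsS d gamma0.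
have w0 i' : (i' + d <= n)%N -> 0 <= wdist i' ^- gamma.
  by move=> h; rewrite invr_ge0 exprn_ge0 // ltW // wdist_gt0.
have C0 : 0 <= \sum_(al.+1 - d <= i < minn al.+1 (n - d).+1) wdist i ^- gamma.
  by rewrite big_nat; apply: sumr_ge0 => i' h; apply: w0; lia.
case: (eqVneq i al.+1) => [iE|ial1].
  rewrite wdist_right ?iE ?subnn //; last by rewrite -iE.
  rewrite -[leLHS]add0r lerD ?addr_ge0 //.
  apply: (signed_window_sum_ge M1 delta0 rsteps0 rsteps0_le rstepsS gamma0); lia.
case: (eqVneq (i + d)%N al) => [idE|idal].
  rewrite wdist_left ?idE //; have -> : (al - d - i = 0)%N by lia.
  rewrite -addrA -[leLHS]addr0 lerD ?addr_ge0 //.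
  apply: (signed_window_sum_ge M1 delta0 lsteps0 lsteps0_le lstepsS gamma0); lia.
rewrite -[leLHS]addr0 lerD // -[leLHS]add0r lerD //.
apply: (@le_trans _ _ (wdist i ^- gamma)).
  rewrite ler_piMl ?w0 // invf_le1 // lerDr.
  exact: le_trans M1.
rewrite (bigD1_seq i) ?iota_uniq ?mem_index_iota //=; last by lia.
rewrite lerDl big_nat_cond; apply: sumr_ge0 => i' h; apply: w0; lia.
Qed.

Lemma den_gt0 : 0 < sgn_den * den.
Proof.
(* A near window always exists; [minn] keeps it inside the grid at the right end. *)
have ni : near_window (minn al (n - d)) by apply/and3P; split; lia.
have := lambda_near_le ni; have M10 : 0 < M + 1 by rewrite ltr_wpDl // (le_trans ler01).
rewrite -ler_pdivrMl //; apply: lt_le_trans.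
by rewrite mulr_gt0 ?invr_gt0 ?exprn_gt0 // wdist_gt0 //; lia.
Qed.

Lemma norm_den : `|den| = sgn_den * den.
Proof. by rewrite -(gtr0_norm den_gt0) normrM /sgn_den -exprM normr_sign mul1r. Qed.

(* i0 = i and k = 1 if window i is near; otherwise i0 is al - d or al + 1 and
   k = |i - i0|. *)
Lemma near_reference i : (i + d <= n)%N -> exists i0 k,
  [/\ near_window i0 /\ (0 < k)%N, wdist i0 <= wdist i,
      wdist i0 / wdist i <= M / k%:R,
      wdist i0 / wdist i <= M ^+ 2 * d.+1%:R / k%:R ^+ 2 &
      ((natdist i al).+1 <= d.+2 * k /\
       natdist i al + d.+1 <= 2 * d.+1 * k)%N].
Proof.
move=> idn; have := wdist_gt0 idn => wi.
case: (boolP (near_window i)) => [ni|].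
  exists i, 1%N; have := ni => /and3P[? ? ?]; split=> //; rewrite /natdist ?divff ?gt_eqF //.
  - by rewrite divr1.
  - rewrite expr1n divr1; apply: (le_trans M1); rewrite expr2 -mulrA.
    by rewrite ler_peMr ?(le_trans ler01) // mulr_ege1 // ler1n.
  - by lia.
move=> ni.
have [ali|idal] : (al.+1 < i)%N \/ (i + d < al)%N.
  by move: ni; rewrite /near_window; lia.
  have k0 : (0 < i - al.+1)%N by lia.
  have kN : (i - al.+1 + d < n - al)%N by lia.
  exists al.+1, (i - al.+1)%N.
  rewrite !wdist_right ?subnn //; [|lia..].
  split=> //.
  - by split=> //; rewrite /near_window; lia.
  - exact: (window0_le M1 delta0 rsteps0 rsteps0_le rstepsS).
  - exact: (window_ratio_le M1 delta0 rsteps0 rsteps0_le rstepsS).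
  - exact: (window_ratio_le_sqr M1 delta0 rsteps0 rsteps0_le rstepsS).
  - by rewrite /natdist; split; nia.
have k0 : (0 < al - d - i)%N by lia.
have kN : (al - d - i + d < al.+1)%N by lia.
exists (al - d)%N, (al - d - i)%N.
rewrite !wdist_left ?subnn //; [|lia..].
split=> //.
- by split=> //; rewrite /near_window; lia.
- exact: (window0_le M1 delta0 lsteps0 lsteps0_le lstepsS).
- exact: (window_ratio_le M1 delta0 lsteps0 lsteps0_le lstepsS).
- exact: (window_ratio_le_sqr M1 delta0 lsteps0 lsteps0_le lstepsS).
(* On this side [natdist i al] is d + k, and both inequalities are equalities at k = 1; this fixes
   the factors d + 2 and 2 (d + 1). *)
- by rewrite /natdist; split; nia.
Qed.

Lemma node_dist_le i j : (i <= j <= i + d)%N -> (i + d <= n)%N ->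
  `|t - x j| <= (natdist i al + d.+1)%:R * (M * delta).
Proof.
move=> jid idn; have Md : 0 <= M * delta by rewrite mulr_ge0 ?(ltW delta0) ?(le_trans ler01).
case: (leqP j al) => jal.
  have [E p] := node_left jal; rewrite gtr0_norm // E.
  have lN : (al - j < al.+1)%N by lia.
  apply: (le_trans (steps_le lsteps0_le lstepsS lN)).
  by rewrite ler_wpM2r // ler_nat /natdist; lia.
have jn : (j <= n)%N by lia.
have [E p] := node_right jal jn; rewrite ltr0_norm // opprB E.
have lN : (j - al.+1 < n - al)%N by lia.
apply: (le_trans (steps_le rsteps0_le rstepsS lN)).
by rewrite ler_wpM2r // ler_nat /natdist; lia.
Qed.

(** As s + 1 < gamma and r <= 1, the weight carries at least r^(s+2). The error uses up one power of
    r and brings L^s, where [L] is the distance bound for the window. What remains is r (r L)^s,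
    whose factor r is summable and whose factor r L does not grow with k. *)
Lemma sum_lambda_error_le (err : nat -> R) (G : R) s : 0 <= G ->
  (s.+1 < gamma)%N ->
  (forall i, (i + d <= n)%N ->
    err i <= G * wdist i * ((natdist i al + d.+1)%:R * (M * delta)) ^+ s) ->
  \sum_(0 <= i < (n - d).+1) `|lam i| * err i <=
    sgn_den * den * (4 * (M + 1) * G * (d.+1`!%:R * (M * delta) ^+ d.+1) *
      (M ^+ 2 * d.+1%:R) * ((2 * d.+1)%:R * M ^+ 2 * delta) ^+ s * d.+2%:R ^+ 2).
Proof.
move=> G0 sg Herr; have D0 := den_gt0; have HD := lambda_near_le.
move: (sgn_den * den) D0 HD => D D0 HD; set C := (d.+1`!%:R * (M * delta) ^+ d.+1).
set E := D * ((M + 1) * G * C *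
  (M ^+ 2 * d.+1%:R) * ((2 * d.+1)%:R * M ^+ 2 * delta) ^+ s * d.+2%:R ^+ 2).
have -> : D * (4 * (M + 1) * G * C *
  (M ^+ 2 * d.+1%:R) * ((2 * d.+1)%:R * M ^+ 2 * delta) ^+ s * d.+2%:R ^+ 2) =
  E * 4 by rewrite /E; ring.
have M0 : 0 < M := lt_le_trans ltr01 M1.
have E0 : 0 <= E.
  rewrite /E /C !mulr_ge0 ?exprn_ge0 ?mulr_ge0 ?exprn_ge0 ?addr_ge0 //;
  exact: ltW.
(* Each summand is compared with E / (natdist i al + 1)^2, and these inverse squares add up to at
   most 4. *)
apply: le_trans (ler_wpM2l E0 (sum_inv_sqr_dist R al (n - d).+1)).
rewrite mulr_sumr; apply: ler_sum_nat => i ind.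
have idn : (i + d <= n)%N by lia.
rewrite norm_lambda //.
have [i0 [k [[near0 k0] w0w r1 r2 [dk Lk]]]] := near_reference idn.
have wi := wdist_gt0 idn.
have wi0 : 0 < wdist i0 by apply: wdist_gt0; case/and3P: near0.
have kR : 0 < (k%:R : R) by rewrite ltr0n.
set r := wdist i0 / wdist i in r1 r2.
have r0 : 0 < r by rewrite divr_gt0.
have rle1 : r <= 1 by rewrite ler_pdivrMr // mul1r.
set L := (natdist i al + d.+1)%:R * (M * delta).
have L0 : 0 <= L by rewrite !mulr_ge0 // ltW.
have wE : wdist i = wdist i0 / r by rewrite /r invf_div mulrC divfK // gt_eqF.
have lamE : wdist i ^- gamma = r ^+ gamma * wdist i0 ^- gamma.
  by rewrite [in LHS]wE expr_div_n invf_div.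
have rpow : r ^+ gamma <= r ^+ s.+2.
  by rewrite -(subnK sg) exprD ler_piMl ?exprn_ge0 ?exprn_ile1 // ltW.
have near_lam := HD _ near0.
have near_w := wdist_near near0; rewrite -/C in near_w.
apply: (@le_trans _ _ (r ^+ s.+2 * ((M + 1) * (D)) *
    (G * (wdist i0 / r) * L ^+ s))).
  rewrite lamE -wE; apply: le_trans (_ : _ <= r ^+ gamma / wdist i0 ^+ gamma *
      (G * wdist i * L ^+ s)) _.
    rewrite ler_wpM2l ?Herr // mulr_ge0 ?invr_ge0 ?exprn_ge0 ?(ltW r0) ?(ltW wi0) //.
  rewrite ler_wpM2r ?mulr_ge0 ?exprn_ge0 ?(ltW wi) //.
  by rewrite ler_pM ?invr_ge0 ?exprn_ge0 ?(ltW r0) ?(ltW wi0).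
have -> : r ^+ s.+2 * ((M + 1) * (D)) * (G * (wdist i0 / r) * L ^+ s) =
    D * ((M + 1) * G) * wdist i0 * (r * (r * L) ^+ s).
  rewrite (exprMn s r L) !(exprS r); move: (r ^+ s) (L ^+ s) => p q.
  by field; rewrite gt_eqF.
have -> : E * ((natdist i al).+1%:R ^+ 2)^-1 =
    D * ((M + 1) * G) * C * ((M ^+ 2 * d.+1%:R *
       (d.+2%:R ^+ 2 * ((natdist i al).+1%:R ^+ 2)^-1)) *
       ((2 * d.+1)%:R * M ^+ 2 * delta) ^+ s).
  rewrite /E; ring.
have DG0 : 0 <= D * ((M + 1) * G).
  by rewrite !mulr_ge0 ?addr_ge0 // ?ltW.
have rL0 : 0 <= r * L := mulr_ge0 (ltW r0) L0.
(* The bound r <= M / k is used here: k cancels against the growth of [L], leaving a multiple of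
   delta. *)
have rL : r * L <= (2 * d.+1)%:R * M ^+ 2 * delta.
  apply: (@le_trans _ _ (M / k%:R * ((2 * d.+1 * k)%:R * (M * delta)))).
    by rewrite ler_pM ?(ltW r0) // ler_wpM2r ?ler_nat // mulr_ge0 ?ltW.
  rewrite natrM le_eqVlt; apply/orP; left; apply/eqP.
  by field; rewrite gt_eqF.
(* The quadratic bound is used here, and k is replaced by (natdist i al + 1) / (d + 2), which it is
   at least. *)
have rk : r <= M ^+ 2 * d.+1%:R * (d.+2%:R ^+ 2 * ((natdist i al).+1%:R ^+ 2)^-1).
  apply: (le_trans r2); rewrite ler_wpM2l ?mulr_ge0 ?exprn_ge0 ?(ltW M0) //.
  rewrite -expr_div_n -exprVn lerXn2r ?nnegrE ?divr_ge0 ?invr_ge0 ?ler0n //.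
  by rewrite ler_pdivlMr ?ltr0n // mulrC ler_pdivrMr // -natrM ler_nat.
apply: ler_pM.
- exact: mulr_ge0 DG0 (ltW wi0).
- exact: mulr_ge0 (ltW r0) (exprn_ge0 _ rL0).
- by rewrite ler_wpM2l.
apply: ler_pM => //; first exact: ltW; first exact: exprn_ge0.
by rewrite lerXn2r ?nnegrE // (le_trans rL0).
Qed.

End Cell.
(** * Convergence rates *)

(** Serves to absorb the polynomial factors in [d] into an exponential. *)
Lemma ltn_expn3 d : (0 < d)%N -> (d.+1 < 3 ^ d)%N.
Proof.
by case: d => // d _; elim: d => [//|d IHd]; rewrite expnS; lia.
Qed.

Lemma locate_cell (R : realType) (x : nat -> R) n t : x 0%N <= t <= x n ->
  (forall k, (k <= n)%N -> t != x k) ->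
  exists2 al, (al < n)%N & x al < t < x al.+1.
Proof.
elim: n => [|n IHn] /andP[x0t txn] tx.
  by have := tx 0%N (leqnn _); rewrite eq_le x0t txn.
case: (leP t (x n)) => txn'.
  have [||al aln H] := IHn; first by rewrite x0t.
    by move=> k kn; apply: tx; exact: leqW.
  by exists al => //; exact: leqW.
by exists n => //; rewrite txn' lt_neqAle txn tx.
Qed.

(** The interpolation error brings delta^-d, the product over a near window delta^(d+1) and the
    factor (r L)^s a further delta^s, so delta^(s+1) remains. The bound is free of [gamma]. *)
Lemma gFH_error_le (R : realType) (M delta t F : R) (f : R -> R)
    (x : nat -> R) (T : {poly R}) n d gamma s al :
  1 <= M -> 0 < delta -> 0 <= F ->
  (forall k, (k < n)%N -> delta <= x k.+1 - x k <= M * delta) ->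
  (al < n)%N -> x al < t < x al.+1 ->
  (0 < d)%N -> (d <= n)%N -> (s <= d)%N -> (s.+1 < gamma)%N ->
  (size T <= s.+1)%N -> T.[t] = f t ->
  (forall j, (j <= n)%N -> `|f (x j) - T.[x j]| <= F * `|x j - t| ^+ s.+1) ->
  `|f t - (\sum_(0 <= i < (n - d).+1)
             lambda d gamma x i t * (interp d x f i).[t])
          / \sum_(0 <= i < (n - d).+1) lambda d gamma x i t| <=
  4 * (M + 1) * F * M ^+ 3 * (2 * M ^+ 2) ^+ s *
  ((2 * M) ^+ d * d.+1%:R ^+ (s + 3) * d.+2%:R ^+ 2) * delta ^+ s.+1.
Proof.
move=> M1 delta0 F0 gap aln tal d0 dn sd sg sT Tt HT.
have g0 : (0 < gamma)%N by lia.
have D0 := den_gt0 M1 delta0 gap aln tal d0 dn g0.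
have DN := norm_den M1 delta0 gap aln tal d0 dn g0.
rewrite -/(den t n d gamma x) in D0 DN *.
have denN : den t n d gamma x != 0.
  by apply: contraTneq D0 => ->; rewrite mulr0 ltxx.
set num := \sum_(0 <= i < _) _.
(* The weights divided by their sum add up to 1, so f t may be moved under the sum. *)
have -> : f t - num / den t n d gamma x =
    (\sum_(0 <= i < (n - d).+1)
      lambda d gamma x i t * (f t - (interp d x f i).[t])) / den t n d gamma x.
  under [in RHS]eq_bigr do rewrite mulrBr.
  by rewrite sumrB -mulr_suml -/num -/(den t n d gamma x) mulrBl [_ * f t]mulrC mulfK.
rewrite normrM normfV DN ler_pdivrMr //.
apply: (le_trans (ler_norm_sum _ _ _)); under eq_bigr do rewrite normrM.
pose G := F * d.+1%:R * (2 ^+ d / (d`!%:R * delta ^+ d)).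
have G0 : 0 <= G by rewrite !mulr_ge0 ?invr_ge0 ?mulr_ge0 ?exprn_ge0 // ltW.
have Herr i : (i + d <= n)%N -> `|f t - (interp d x f i).[t]| <=
    G * wdist t d x i * ((natdist i al + d.+1)%:R * (M * delta)) ^+ s.
  move=> idn.
  have -> : G * wdist t d x i * ((natdist i al + d.+1)%:R * (M * delta)) ^+ s =
    F * wdist t d x i * d.+1%:R * ((natdist i al + d.+1)%:R * (M * delta)) ^+ s *
    (2 ^+ d / (d`!%:R * delta ^+ d)) by rewrite /G; ring.
  apply: (@interp_error _ _ _ T _ _ _ _ n) => // [k kn|j jid].
    by have /andP[] := gap _ kn.
  exact: (node_dist_le M1 delta0 gap aln tal d0 dn g0).
apply: (le_trans (sum_lambda_error_le M1 delta0 gap aln tal d0 dn g0 G0 sg Herr)).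
rewrite mulrC ler_wpM2r ?(ltW D0) // le_eqVlt; apply/orP; left; apply/eqP.
rewrite /G factS !natrM !exprMn !exprS exprD.
have fN : (d`!%:R : R) != 0 by rewrite pnatr_eq0 -lt0n fact_gt0.
have dN : delta ^+ d != 0 by rewrite expf_neq0 // gt_eqF.
move: (d`!%:R : R) fN (delta ^+ d) dN => p p0 q q0.
move: (M ^+ d) (M ^+ s) (2 ^+ d) (2 ^+ s) (d.+1%:R ^+ s) (delta ^+ s) => *.
by field; rewrite q0.
Qed.

(** [K] and [B] are fixed before [d], [gamma], [n], the grid and t, which makes the estimate uniform
    in all of these. *)
Definition gFH_rate_bound (R : realType) (a b : R) (f : R -> R) (M : R) s K B :=
  forall d gamma n x (delta t : R), (0 < d)%N -> (s <= d.+1)%N ->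
    (s < gamma)%N -> (d <= n)%N -> grid a b n x -> 0 < delta ->
    (forall k, (k < n)%N -> delta <= x k.+1 - x k <= M * delta) ->
    delta * n%:R <= M -> a <= t <= b ->
    `|f t - gFH n d gamma x f t| <= K * B ^+ d * (n%:R ^+ s)^-1.

Lemma gFH_rate_boundS (R : realType) (a b : R) (f : R -> R) (M : R) s :
  1 <= M -> Cs a b s.+1 f ->
  exists K B, [/\ 0 < K, 1 < B & gFH_rate_bound a b f M s.+1 K B].
Proof.
move=> M1 /Cs_taylor[F F0 HF]; have M0 := lt_le_trans ltr01 M1.
(* F + 1 keeps [K] positive when F = 0; the last factor M^(s+1) comes from delta <= M / n. *)
pose K := 4 * (M + 1) * (F + 1) * M ^+ 3 * (2 * M ^+ 2) ^+ s * M ^+ s.+1.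
have M10 : 0 < M + 1 by rewrite ltr_wpDl // ltW.
have F10 : 0 < F + 1 by rewrite ltr_wpDl.
have A0 : 0 < 4 * (M + 1) * (F + 1) * M ^+ 3 * (2 * M ^+ 2) ^+ s.
  by rewrite !(mulr_gt0, exprn_gt0).
have K0 : 0 < K by rewrite mulr_gt0 // exprn_gt0.
(* The power of 3 comes from (d + 1)^(s+3) (d + 2)^2 <= (3^d)^(s+5). *)
exists K, (2 * M * 3 ^+ (s + 5)); split => //.
- have : 1 <= (3 : R) ^+ (s + 5) by rewrite exprn_ege1 // ler1n.
  nra.
move=> d gamma n x delta t d0 sd sg dn gx delta0 gap dnM tab.
have n0 : 0 < (n%:R : R) by rewrite ltr0n; lia.
rewrite /gFH; case: ifPn => [_|].
  rewrite subrr normr0; apply: mulr_ge0; last by rewrite invr_ge0 exprn_ge0.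
  by apply: mulr_ge0 (ltW K0) _; rewrite exprn_ge0 // !mulr_ge0 ?exprn_ge0 // ltW.
rewrite negb_exists => /forallP tx.
have [x0 xn _] := gx.
have [||al aln tal] := @locate_cell _ x n t; first by rewrite x0 xn.
  by move=> k kn; exact: (tx (Ordinal (n := n.+1) (m := k) kn)).
have [T sT HT] := HF t tab.
have Tt : T.[t] = f t.
  apply/eqP; rewrite eq_sym -subr_eq0 -normr_le0.
  by have := HT t tab; rewrite subrr normr0 expr0n mulr0.
have HT' j : (j <= n)%N -> `|f (x j) - T.[x j]| <= (F + 1) * `|x j - t| ^+ s.+1.
  move=> jn; apply: le_trans (HT (x j) _) _; last first.
    by rewrite ler_wpM2r ?exprn_ge0 // lerDl.
  rewrite -x0 -xn; apply/andP; split.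
    case: j jn => // j jn; apply/ltW/(grid_lt gx) => //.
  move: jn; rewrite leq_eqVlt => /predU1P[-> //|jn].
  exact/ltW/(grid_lt gx).
apply: (le_trans (gFH_error_le M1 delta0 _ gap aln tal d0 dn _ sg sT Tt HT')) => //.
  by rewrite addr_ge0.
have d3 : (d.+2%:R : R) <= 3 ^+ d.
  by rewrite -natrX ler_nat ltn_expn3.
have d13 : (d.+1%:R : R) <= 3 ^+ d by apply: le_trans d3; rewrite ler_nat.
have dpow : (d.+1%:R : R) ^+ (s + 3) * d.+2%:R ^+ 2 <= (3 ^+ (s + 5)) ^+ d.
  have -> : (3 ^+ (s + 5)) ^+ d = (3 ^+ d) ^+ (s + 3) * (3 ^+ d) ^+ 2 :> R.
    by rewrite -!exprM -exprD -mulnDr -addnA mulnC.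
  by apply: ler_pM; rewrite ?exprn_ge0 // lerXn2r ?nnegrE ?exprn_ge0.
have deltan : delta ^+ s.+1 <= M ^+ s.+1 * (n%:R ^+ s.+1)^-1.
  rewrite -expr_div_n lerXn2r ?nnegrE ?divr_ge0 ?(ltW M0) ?(ltW delta0) ?(ltW n0) //.
  by rewrite ler_pdivlMr.
have -> : K * (2 * M * 3 ^+ (s + 5)) ^+ d / n%:R ^+ s.+1 =
  4 * (M + 1) * (F + 1) * M ^+ 3 * (2 * M ^+ 2) ^+ s *
  ((2 * M) ^+ d * (3 ^+ (s + 5)) ^+ d) * (M ^+ s.+1 / n%:R ^+ s.+1).
  rewrite /K (exprMn d (2 * M)); ring.
have B0 : 0 <= (2 * M) ^+ d by rewrite exprn_ge0 // mulr_ge0 // ltW.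
apply: ler_pM deltan.
- apply: mulr_ge0 (ltW A0) _; rewrite -mulrA; exact: mulr_ge0.
- by rewrite exprn_ge0 // ltW.
by rewrite ler_wpM2l ?(ltW A0) // -mulrA ler_wpM2l.
Qed.

Lemma gFH_rate_bound_mono (R : realType) (a b : R) (f : R -> R) (M : R) s
    (K B K' B' : R) :
  0 < K -> 1 < B -> K <= K' -> B <= B' ->
  gFH_rate_bound a b f M s K B -> gFH_rate_bound a b f M s K' B'.
Proof.
move=> K0 B1 KK BB H d gamma n x delta t h1 h2 h3 h4 h5 h6 h7 h8 h9.
apply: (le_trans (H d gamma n x delta t h1 h2 h3 h4 h5 h6 h7 h8 h9)).
have B0 : 0 <= B := le_trans ler01 (ltW B1).
rewrite ler_wpM2r ?invr_ge0 ?exprn_ge0 // ler_pM ?exprn_ge0 ?(ltW K0) //.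
by rewrite lerXn2r ?nnegrE // (le_trans B0).
Qed.

(** For gamma <= s the order gamma - 1 will be used, while the constants may not depend on [gamma];
    the maxima over the finitely many orders up to [s] serve them all. *)
Lemma gFH_rate_bound_upto (R : realType) (a b : R) (f : R -> R) (M : R) s :
  1 <= M -> Cs a b s f ->
  exists K B, [/\ 0 < K, 1 < B &
    forall s', (0 < s' <= s)%N -> gFH_rate_bound a b f M s' K B].
Proof.
move=> M1; elim: s => [|s IHs] fs.
  by exists 1, 2; split=> //; [rewrite ltr1n|case].
have [K1 [B1 [K10 B11 H1]]] := IHs (Cs_pred fs).
have [K2 [B2 [K20 B21 H2]]] := gFH_rate_boundS M1 fs.
exists (Num.max K1 K2), (Num.max B1 B2); split.
- by rewrite lt_max K10.
- by rewrite lt_max B11.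
move=> s' /andP[s'0]; rewrite leq_eqVlt => /predU1P[->|s's].
  by apply: gFH_rate_bound_mono H2 => //; rewrite le_max lexx orbT.
by apply: gFH_rate_bound_mono (H1 s' _) => //; rewrite ?le_max ?lexx // s'0.
Qed.

(** Reduces the mesh hypotheses to the single scale delta = [hmin n x]. *)
Lemma sim_gap (R : realType) (m M : R) n (x : nat -> R) :
  0 < m -> (0 < n)%N -> sim m M (hmax n x) (hmin n x) ->
  sim m M (hmin n x) (n%:R)^-1 ->
  [/\ 0 < hmin n x, hmin n x * n%:R <= M &
    forall k, (k < n)%N -> hmin n x <= x k.+1 - x k <= M * hmin n x].
Proof.
move=> m0 n0 /andP[_ hM]; rewrite /sim invrK => /andP[mh hn].
have nR : 0 < (n%:R : R) by rewrite ltr0n.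
have h0 : 0 < hmin n x by rewrite -(pmulr_lgt0 _ nR) (lt_le_trans m0).
split=> // k kn; apply/andP; split.
  exact: (bigmin_le_cond _ (fun k : 'I_n => x k.+1 - x k) (j := Ordinal kn)).
rewrite -ler_pdivrMr //; apply: le_trans hM; rewrite ler_wpM2r ?invr_ge0 ?(ltW h0) //.
exact: (le_bigmax_cond _ (fun k : 'I_n => x k.+1 - x k) (j := Ordinal kn)).
Qed.

(** The factor B^d expresses the exponential growth in [d], and the choice of [K] and [B] before
    [gamma] the boundedness in [gamma]. In the logarithmic case n >= 2 is demanded because ln 1 = 0
    would assert a vanishing error. *)
Theorem theorem5p3 (R : realType) (a b : R) (hab : a < b)
    (s : nat) (hs : (1 <= s)%N) (f : R -> R) (hf : Cs a b s f)
    (m M : R) (hm : 0 < m) (hM : 0 < M) :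
  exists K B : R, [/\ 0 < K, 1 < B &
    forall d gamma n : nat, forall x : nat -> R,
      (1 <= d)%N -> (s <= d + 1)%N -> (2 <= gamma)%N -> (d <= n)%N ->
      (gamma = s.+1 -> (2 <= n)%N) ->
      grid a b n x ->
      sim m M (hmax n x) (hmin n x) -> sim m M (hmin n x) (n%:R)^-1 ->
      forall t : R, a <= t <= b ->
        `|f t - gFH n d gamma x f t| <= K * B ^+ d * rate R s gamma n].
Proof.
have M1 : 1 <= M + 1 by rewrite lerDr ltW.
have [K [B [K0 B1 H]]] := gFH_rate_bound_upto M1 hf.
have ln2 : 0 < ln (2 : R) by rewrite ln_gt0 // ltr1n.
(* The term K / ln 2 handles the logarithmic case, where 1 <= ln n / ln 2 for n >= 2. *)
exists (K + K / ln 2), B; split=> //; first by rewrite addr_gt0 // divr_gt0.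
move=> d gamma n x d1 sd g2 dn gn gx hmM hmn t tab.
have n0 : (0 < n)%N by exact: leq_trans dn.
have nR : 0 < (n%:R : R) by rewrite ltr0n.
have [h0 hn gap] := sim_gap hm n0 hmM hmn.
have Bd : 0 <= B ^+ d by rewrite exprn_ge0 // (le_trans ler01) // ltW.
have key s' : (0 < s' <= s)%N -> (s' < gamma)%N ->
    `|f t - gFH n d gamma x f t| <= K * B ^+ d * (n%:R ^+ s')^-1.
  move=> s's s'g; apply: (H s' s's d gamma n x (hmin n x)) => //.
  - by rewrite -addn1 (leq_trans _ sd) //; case/andP: s's.
  - move=> k kn; have /andP[-> u] := gap k kn; apply: (le_trans u).
    by rewrite ler_wpM2r ?lerDl // ltW.
  - by rewrite (le_trans hn) // lerDl.
have ss : (0 < s <= s)%N by rewrite hs /=.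
have KK : K * B ^+ d <= (K + K / ln 2) * B ^+ d.
  by rewrite ler_wpM2r // lerDl divr_ge0 // ltW.
have weak s' : (0 < s' <= s)%N -> (s' < gamma)%N ->
    `|f t - gFH n d gamma x f t| <= (K + K / ln 2) * B ^+ d * (n%:R ^+ s')^-1.
  move=> s's s'g; apply: (le_trans (key s' s's s'g)).
  by rewrite ler_wpM2r // invr_ge0 exprn_ge0.
rewrite /rate; case: ifPn => [sg|]; first by apply: weak => //; exact: ltnW.
rewrite -leqNgt => gs; case: eqP => [gE|_].
  apply: (le_trans (key s ss _)); first by rewrite gE.
  rewrite mulrA ler_wpM2r ?invr_ge0 ?exprn_ge0 // mulrAC ler_wpM2r //.
  have ln2n : ln 2 <= ln (n%:R : R).
    by rewrite ler_ln ?posrE // ler_nat; exact: gn.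
  apply: (@le_trans _ _ (K / ln 2 * ln 2)); first by rewrite divfK // gt_eqF.
  apply: ler_pM => //; [by rewrite divr_ge0 // ltW|exact: ltW|].
  by rewrite lerDr ltW.
(* Here 2 <= gamma <= s, so the order gamma - 1 is positive, at most [s] and below [gamma]. *)
apply: weak; last by rewrite ltn_subrL (ltnW g2).
by rewrite subn_gt0 g2 leq_subLR add1n.
Qed.
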